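(* Let $E$ be a vector bundle of rank $>1$ over a smooth manifold $M$, and let $[\cdot,\cdot]$ be a bracket on $\mathcal{E}=\mathrm{Sec}(E)$. If $(\mathcal{E},[\cdot,\cdot])$ is a QD-algebroid (resp., a Loday QD-algebroid, or a Lie QD-algebroid), then it is an algebroid (resp., a Loday algebroid, or a Lie algebroid).
   Context: $\mathcal{A}=C^\infty(M)$ is the algebra of real smooth functions on $M$, and $\mathcal{E}=\mathrm{Sec}(E)$ is the $\mathcal{A}$-module of smooth sections of the real vector bundle $E$ over $M$, whose fibers all have the same finite dimension $k=\mathrm{rank}(E)$. An $\mathbb{R}$-linear operator $D:\mathcal{E}\to\mathcal{E}$ is a quasi-$\mathcal{A}$-derivation if for each $f\in\mathcal{A}$ there is $\widehat{D}(f)\in\mathcal{A}$ such that $D(fX)=fD(X)+\widehat{D}(f)X$ for all $X\in\mathcal{E}$; then (for $k\ge 1$) $\widehat{D}$ is uniquely determined and is a derivation of $\mathcal{A}$. A QD-algebroid is an $\mathbb{R}$-bilinear bracket $[\cdot,\cdot]$ on $\mathcal{E}$ which is a quasi-$\mathcal{A}$-derivation of $\mathcal{E}$ in each variable separately. Hence $[X,fY]=f[X,Y]+\widehat{X}(f)Y$ and $[fX,Y]=f[X,Y]+\widetilde{Y}(f)X$ for all $X,Y\in\mathcal{E}$, $f\in\mathcal{A}$, where $X\mapsto\widehat{X}\in\mathrm{Der}(\mathcal{A})$ and $Y\mapsto\widetilde{Y}\in\mathrm{Der}(\mathcal{A})$ are called the left and right anchor maps. Its rank is the rank of $E$. An algebroid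 is a QD-algebroid whose left and right anchor maps are both $\mathcal{A}$-linear (tensorial). A Loday QD-algebroid (resp. Loday algebroid) is a QD-algebroid (resp. algebroid) whose bracket satisfies the Jacobi identity $[[X,Y],Z]=[X,[Y,Z]]-[Y,[X,Z]]$ (no skew-symmetry is assumed). A Lie QD-algebroid is a QD-algebroid whose bracket is a Lie algebra bracket. A Lie algebroid on $E$ is an $\mathbb{R}$-bilinear, alternating bracket on $\mathcal{E}$ satisfying the Jacobi identity, together with a $C^\infty(M)$-linear map (anchor) $a:\mathcal{E}\to\mathrm{Der}(C^\infty(M))$ (equivalently, a vector bundle morphism $a:E\to TM$ over the identity) such that $[X,fY]=f[X,Y]+a(X)(f)Y$ and $a([X,Y])=[a(X),a(Y)]$ (commutator of derivations) for all $X,Y\in\mathcal{E}$, $f\in C^\infty(M)$; here the anchor is the left anchor map. *)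

(* Defs.v *)
From HB Require Import structures.
From mathcomp Require Import all_boot all_order all_algebra.
From mathcomp Require Import all_classical all_reals.
From mathcomp Require Import topology normedtype landau derive.

Set Implicit Arguments.
Unset Strict Implicit.
Unset Printing Implicit Defensive.

Import Order.TTheory GRing.Theory Num.Theory.
Import numFieldNormedType.Exports.

Local Open Scope classical_set_scope.
Local Open Scope ring_scope.

Lemma near_eq_differentiable (R : realType) (V W : normedModType R)
    (f g : V -> W) (x : V) :
  (\near x, f x = g x) -> differentiable f x -> differentiable g x.
Proof.
move=> fg df.
have fgx : f x = g x by exact: nbhs_singleton fg.
have cdf : continuous ('d f x) by exact: diff_continuous.
have gE : g \o shift x = cst (g x) + 'd f x +o_ 0 id.
  have /eqaddoP fE := diff_locally df.
  apply/eqaddoP => e e0.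
  have h0 : \forall z \near (0 : V), f (z + x) = g (z + x).
    by move: fg; rewrite (near_shift (0 : V)) subr0.
  apply: filterS2 h0 (fE e e0) => z /= fgz.
  have -> : (f \o shift x - (cst (f x) + 'd f x)) z =
      (g \o shift x - (cst (g x) + 'd f x)) z by rewrite !fctE /= fgz fgx.
  exact.
by apply/diff_locallyP; rewrite (diff_unique cdf gE); exact: conj.
Qed.

Section SmoothOn.
Context {R : realType} {n : nat}.
Implicit Types (U V : set 'rV[R]_n) (f g : 'rV[R]_n -> R).

(* Meant for open U: 'D_v f x involves f on a neighbourhood of x. *)
Fixpoint Ck (k : nat) U f : Prop :=
  if k is k'.+1 then
    (forall x, U x -> differentiable f x) /\
    (forall i : 'I_n, Ck k' U ('D_(delta_mx 0 i) f))
  else forall x, U x -> {for x, continuous f}.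

Definition smooth_on U f := forall k, Ck k U f.

Lemma Ck_sub k U V f : V `<=` U -> Ck k U f -> Ck k V f.
Proof.
move=> VU; elim: k f => [|k IH] f /=; first by move=> fU x /VU; exact: fU.
by case=> df Df; split=> [x /VU|i]; [exact: df|exact: IH].
Qed.

Lemma Ck_ext k U f g : open U -> (forall x, U x -> f x = g x) ->
  Ck k U f -> Ck k U g.
Proof.
move=> oU; elim: k f g => [|k IH] f g fg.
  move=> fU x Ux; rewrite /prop_for /continuous_at -(fg x Ux).
  have nfg : \near x, f x = g x.
    by exact: (filterS fg) (open_nbhs_nbhs (conj oU Ux)).
  exact: cvg_trans (near_eq_cvg nfg) (fU x Ux).
have nfg x : U x -> \near x, f x = g x.
  by move=> Ux; exact: (filterS fg) (open_nbhs_nbhs (conj oU Ux)).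
move=> [df Df]; split=> [x Ux|i].
  by apply: near_eq_differentiable (nfg x Ux) _; exact: df.
apply: (IH _ _ _ (Df i)) => x Ux.
by apply: near_eq_derive; exact: nfg.
Qed.

Lemma CkS k U f : Ck k.+1 U f -> Ck k U f.
Proof.
elim: k f => [|k IH] f [df Df] /=.
  by move=> x Ux; apply: differentiable_continuous; exact: df.
by split=> // i; exact: IH.
Qed.

Lemma CkD k U f g : open U -> Ck k U f -> Ck k U g -> Ck k U (f + g).
Proof.
move=> oU; elim: k f g => [|k IH] f g /=.
  by move=> fU gU x Ux; apply: continuousD; [exact: fU|exact: gU].
move=> [df Df] [dg Dg]; split=> [x Ux|i].
  by apply: differentiableD; [exact: df|exact: dg].
apply: Ck_ext (IH _ _ (Df i) (Dg i)) => // x Ux.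
by rewrite deriveD//; apply: diff_derivable; [exact: df|exact: dg].
Qed.

Lemma CkM k U f g : open U -> Ck k U f -> Ck k U g -> Ck k U (f * g).
Proof.
move=> oU; elim: k f g => [|k IH] f g.
  by move=> fU gU x Ux; apply: continuousM; [exact: fU|exact: gU].
move=> fU gU; have [df Df] := fU; have [dg Dg] := gU; split=> [x Ux|i].
  by apply: differentiableM; [exact: df|exact: dg].
apply: Ck_ext (CkD oU (IH _ _ (CkS fU) (Dg i)) (IH _ _ (CkS gU) (Df i))) => //.
move=> x Ux.
by rewrite deriveM//; apply: diff_derivable; [exact: df|exact: dg].
Qed.

Lemma Ck_cst k U (r : R) : open U -> Ck k U (cst r).
Proof.
move=> oU; elim: k r => [|k IH] r /=; first by move=> x _; exact: cst_continuous.
split=> [x _|i]; first exact: differentiable_cst.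
by apply: Ck_ext (IH 0) => // x _; rewrite derive_cst.
Qed.

End SmoothOn.

(* A chart is encoded by total maps in both directions; only the values of
   coord on dom and of par on coord @` dom are meaningful. *)
Record chart (R : realType) (n : nat) (T : topologicalType) := Chart {
  dom : set T;
  coord : T -> 'rV[R]_n;
  par : 'rV[R]_n -> T;
  dom_open : open dom;
  codom_open : open (coord @` dom);
  coordK : {in dom, cancel coord par};
  coord_continuous : {within dom, continuous coord};
  par_continuous : {within coord @` dom, continuous par} }.

Definition chart_compat (R : realType) (n : nat) (T : topologicalType)
    (c d : chart R n T) :=
  forall j, smooth_on (coord c @` (dom c `&` dom d))
    (fun x => coord d (par c x) 0 j).

(* Smooth manifold of dimension n without boundary; the smooth structure is
   given by an atlas, not required to be maximal. *)
Record manifold (R : realType) (n : nat) := Manifold {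
  points :> topologicalType;
  atlas : set (chart R n points);
  manifold_hausdorff : hausdorff_space points;
  manifold_second_countable : @second_countable points;
  atlas_cover : forall p : points, exists2 c, atlas c & dom c p;
  atlas_compat : forall c d, atlas c -> atlas d -> chart_compat c d }.

(* Smoothness on an open subset W of M, read in the charts. *)
Definition msmooth_on (R : realType) (n : nat) (M : manifold R n)
    (W : set M) (f : M -> R) :=
  forall c, atlas c -> smooth_on (coord c @` (W `&` dom c)) (f \o par c).

Section ManifoldSmoothOn.
Context {R : realType} {n : nat} {M : manifold R n}.
Implicit Types (W : set M) (f g : M -> R).

Lemma coord_open (c : chart R n M) W :
  open W -> open (coord c @` (W `&` dom c)).
Proof.
move=> oW.
have -> : coord c @` (W `&` dom c) = coord c @` dom c `&` par c @^-1` W.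
  apply/seteqP; split=> [_ [p [Wp dp] <-]|_ [[p dp <-]]] /=.
    by split; [exists p|rewrite coordK// inE].
  by rewrite coordK ?inE// => Wp; exists p.
have cpar := @par_continuous _ _ _ c.
rewrite continuous_open_subspace in cpar; last exact: codom_open.
exact: ((continuous_inP _ (@codom_open _ _ _ c)).1 cpar _ oW).
Qed.

Lemma msmooth_on_sub W W' f : W' `<=` W -> msmooth_on W f -> msmooth_on W' f.
Proof.
move=> W'W fW c cM k; apply: Ck_sub (fW c cM k).
by move=> _ [p [Wp dp] <-]; exists p => //; split => //; exact: W'W.
Qed.

Lemma msmooth_onD W f g : open W ->
  msmooth_on W f -> msmooth_on W g -> msmooth_on W (f + g).
Proof.
move=> oW fW gW c cM k.
by apply: CkD; [exact: coord_open|exact: fW|exact: gW].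
Qed.

Lemma msmooth_onM W f g : open W ->
  msmooth_on W f -> msmooth_on W g -> msmooth_on W (f * g).
Proof.
move=> oW fW gW c cM k.
by apply: CkM; [exact: coord_open|exact: fW|exact: gW].
Qed.

Lemma msmooth_on_cst W (r : R) : open W -> msmooth_on W (cst r).
Proof. by move=> oW c cM k; apply: Ck_cst; exact: coord_open. Qed.

Lemma msmooth_onN W f : open W -> msmooth_on W f -> msmooth_on W (- f).
Proof.
move=> oW fW; have -> : - f = cst (-1) * f.
  by apply/funext => x; rewrite !fctE mulN1r.
by apply: msmooth_onM => //; exact: msmooth_on_cst.
Qed.

End ManifoldSmoothOn.

Section SmoothFun.
Context {R : realType} {n : nat} (M : manifold R n).

Definition smooth_pred : {pred M -> R} := mem [set f | @msmooth_on R n M setT f].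

Lemma smooth_subring_closed : subring_closed smooth_pred.
Proof.
split=> [|f g|f g]; rewrite /smooth_pred ?inE /=.
- by apply: msmooth_on_cst; exact: openT.
- move=> fM gM; apply: msmooth_onD => //; first exact: openT.
  by apply: msmooth_onN => //; exact: openT.
- by move=> fM gM; apply: msmooth_onM => //; exact: openT.
Qed.

Record smooth_fun := SmoothFun {
  smooth_val :> M -> R; smooth_valP : smooth_val \in smooth_pred }.

HB.instance Definition _ := [isSub for smooth_val].
HB.instance Definition _ := [Choice of smooth_fun by <:].
HB.instance Definition _ := GRing.SubChoice_isSubComPzRing.Build
  (M -> R) smooth_pred smooth_fun smooth_subring_closed.

Lemma smooth_cst_subproof (r : R) : cst r \in smooth_pred.
Proof. by rewrite /smooth_pred inE; apply: msmooth_on_cst; exact: openT. Qed.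

Definition smooth_cst (r : R) : smooth_fun := SmoothFun (smooth_cst_subproof r).

Lemma smooth_funP (f : smooth_fun) : @msmooth_on R n M setT f.
Proof. by have := smooth_valP f; rewrite /smooth_pred inE. Qed.

End SmoothFun.

(* Local trivialization of a family of vector spaces; as for charts, only the
   values over tdom are meaningful. *)
Record trivialization (R : realType) (k : nat) (T : topologicalType)
    (F : T -> lmodType R) := Trivialization {
  tdom : set T;
  triv : forall p, {linear F p -> 'rV[R]_k};
  trivV : forall p, 'rV[R]_k -> F p;
  tdom_open : open tdom;
  trivK : forall p, tdom p -> cancel (@triv p) (@trivV p);
  trivVK : forall p, tdom p -> cancel (@trivV p) (@triv p) }.

(* Since trivV s p followed by triv t p is linear in v, this says that the
   entries of the transition matrix are smooth functions of the base point. *)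
Definition triv_compat (R : realType) (n k : nat) (M : manifold R n)
    (F : M -> lmodType R) (s t : trivialization k F) :=
  forall (v : 'rV[R]_k) j,
    msmooth_on (tdom s `&` tdom t) (fun p => triv t p (trivV s p v) 0 j).

(* Smooth real vector bundle of rank k, given by its fibers and a smooth
   vector bundle atlas (which determines the manifold structure on the total
   space). *)
Record vector_bundle (R : realType) (n : nat) (M : manifold R n) (k : nat) :=
  VectorBundle {
  fiber :> M -> lmodType R;
  bundle_atlas : set (trivialization k fiber);
  bundle_cover : forall p : M, exists2 t, bundle_atlas t & tdom t p;
  bundle_compat : forall s t,
    bundle_atlas s -> bundle_atlas t -> triv_compat s t }.

(* Sec E carries only its C^oo(M)-module structure; real scalars act through
   the constant functions smooth_cst M r. *)
Section Sections.
Context {R : realType} {n k : nat} {M : manifold R n} (E : vector_bundle M k).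

Definition smooth_section (X : forall p, E p) :=
  forall t, bundle_atlas t -> forall j,
    msmooth_on (tdom t) (fun p => triv t p (X p) 0 j).

Record Sec := MkSec {
  sec_val :> forall p, E p; sec_valP : smooth_section sec_val }.

HB.instance Definition _ := gen_eqMixin Sec.
HB.instance Definition _ := gen_choiceMixin Sec.

Lemma SecP (X Y : Sec) : (forall p, X p = Y p) -> X = Y.
Proof.
case: X Y => [X sX] [Y sY] /= XY.
have {}XY : X = Y by exact: functional_extensionality_dep.
by subst Y; congr MkSec; exact: Prop_irrelevance.
Qed.

Lemma sec_scale_subproof (f : smooth_fun M) (X : Sec) :
  smooth_section (fun p => f p *: X p).
Proof.
move=> t tE j.
have -> : (fun p => triv t p (f p *: X p) 0 j) =
    (f : M -> R) * (fun p => triv t p (X p) 0 j).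
  by apply/funext => p; rewrite linearZ mxE.
apply: msmooth_onM; [exact: tdom_open| |exact: (sec_valP X)].
exact: (msmooth_on_sub (@subsetT _ _) (smooth_funP f)).
Qed.

Lemma sec_add_subproof (X Y : Sec) : smooth_section (fun p => X p + Y p).
Proof.
move=> t tE j.
have -> : (fun p => triv t p (X p + Y p) 0 j) =
    (fun p => triv t p (X p) 0 j) + (fun p => triv t p (Y p) 0 j).
  by apply/funext => p; rewrite linearD mxE.
by apply: msmooth_onD; [exact: tdom_open|exact: (sec_valP X)|exact: (sec_valP Y)].
Qed.

Lemma sec_zero_subproof : smooth_section (fun p => 0).
Proof.
move=> t tE j.
have -> : (fun p => triv t p 0 0 j) = cst 0.
  by apply/funext => p; rewrite linear0 mxE.
by apply: msmooth_on_cst; exact: tdom_open.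
Qed.

Definition sec_scale f X := MkSec (sec_scale_subproof f X).
Definition sec_add X Y := MkSec (sec_add_subproof X Y).
Definition sec_zero := MkSec sec_zero_subproof.
Definition sec_opp X := sec_scale (-1) X.

Fact sec_addA : associative sec_add.
Proof. by move=> X Y Z; apply: SecP => p; exact: addrA. Qed.
Fact sec_addC : commutative sec_add.
Proof. by move=> X Y; apply: SecP => p; exact: addrC. Qed.
Fact sec_add0 : left_id sec_zero sec_add.
Proof. by move=> X; apply: SecP => p; exact: add0r. Qed.
Fact sec_addN : left_inverse sec_zero sec_opp sec_add.
Proof. by move=> X; apply: SecP => p /=; rewrite scaleN1r addNr. Qed.

HB.instance Definition _ :=
  GRing.isZmodule.Build Sec sec_addA sec_addC sec_add0 sec_addN.

Fact sec_scaleA f g X : sec_scale f (sec_scale g X) = sec_scale (f * g) X.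
Proof. by apply: SecP => p; exact: scalerA. Qed.
Fact sec_scale1 : left_id 1 sec_scale.
Proof. by move=> X; apply: SecP => p; exact: scale1r. Qed.
Fact sec_scaleDr : right_distributive sec_scale +%R.
Proof. by move=> f X Y; apply: SecP => p; exact: scalerDr. Qed.
Fact sec_scaleDl X : {morph sec_scale^~ X : f g / f + g}.
Proof. by move=> f g; apply: SecP => p; exact: scalerDl. Qed.

HB.instance Definition _ := GRing.Zmodule_isLmodule.Build (smooth_fun M) Sec
  sec_scaleA sec_scale1 sec_scaleDr sec_scaleDl.

End Sections.

Section Algebroids.
Context {R : realType} {n k : nat} {M : manifold R n} {E : vector_bundle M k}.
Local Notation A := (smooth_fun M).
Local Notation S := (Sec E).
Implicit Types (f g : A) (X Y Z : S) (D : S -> S) (br : S -> S -> S).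

Definition derivation (d : A -> A) :=
  (forall (r : R) f g, d (smooth_cst M r * f + g) = smooth_cst M r * d f + d g) /\
  (forall f g, d (f * g) = d f * g + f * d g).

Definition R_linear D :=
  forall (r : R) X Y, D (smooth_cst M r *: X + Y) = smooth_cst M r *: D X + D Y.

Definition R_bilinear br :=
  (forall X, R_linear (br X)) /\ (forall Y, R_linear (br^~ Y)).

Definition symbol_spec D f df := forall X, D (f *: X) = f *: D X + df *: X.

Definition quasi_derivation D :=
  R_linear D /\ forall f, exists df, symbol_spec D f df.

(* \hat D: for a quasi-derivation D and 0 < k, symbol_spec D f has exactly one
   solution; the default 0 is used otherwise. *)
Definition symbol D f : A := xget 0 [set df | symbol_spec D f df].

Definition left_anchor br X : A -> A := symbol (br X).
Definition right_anchor br Y : A -> A := symbol (br^~ Y).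

(* a is an A-linear map from Sec(E) to Der(A). *)
Definition tensorial (a : S -> A -> A) :=
  (forall X, derivation (a X)) /\
  (forall f X Y g, a (f *: X + Y) g = f * a X g + a Y g).

Definition jacobi br :=
  forall X Y Z, br (br X Y) Z = br X (br Y Z) - br Y (br X Z).

Definition alternating br := forall X, br X X = 0.

Definition lie_bracket br := [/\ R_bilinear br, alternating br & jacobi br].

Definition QD_algebroid br :=
  [/\ R_bilinear br, forall X, quasi_derivation (br X) &
      forall Y, quasi_derivation (br^~ Y)].

Definition algebroid br :=
  [/\ QD_algebroid br, tensorial (left_anchor br) &
      tensorial (right_anchor br)].

Definition loday_QD_algebroid br := QD_algebroid br /\ jacobi br.

Definition loday_algebroid br := algebroid br /\ jacobi br.

Definition lie_QD_algebroid br := QD_algebroid br /\ lie_bracket br.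

Definition lie_algebroid br (a : S -> A -> A) :=
  [/\ lie_bracket br, tensorial a,
      forall X f Y, br X (f *: Y) = f *: br X Y + a X f *: Y &
      forall X Y f, a (br X Y) f = a X (a Y f) - a Y (a X f)].

End Algebroids.

(* Main.v *)
(* Expanding [fX, gY] by the two Leibniz rules in either order, and writing
   l and r for the left and right anchors, gives
     (l_(fX)(g) - f l_X(g)) Y = (r_(gY)(f) - g r_Y(f)) X.
   The coefficient on the left does not depend on Y. If it were nonzero at p,
   the value Y(p) would lie on the line spanned by X(p) for every section Y,
   which is impossible in rank > 1, because every vector of E_p is the value of
   a global section. Hence l is tensorial, and r is too by reversing the
   bracket. Vectors are extended to global sections by means of bump functions,
   equal to the product over j of exp(-1/(e^2 - (x_j - a_j)^2)) on a box. *)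

Require Import Defs.
From mathcomp Require Import all_boot all_order all_algebra.
From mathcomp Require Import all_classical all_reals.
From mathcomp Require Import topology normedtype landau derive realfun sequences exp.
From mathcomp Require Import ring.
(* Makes Defs.coord take precedence over vector.coord. *)
Import Defs.

Set Implicit Arguments.
Unset Strict Implicit.
Unset Printing Implicit Defensive.
Import Order.TTheory GRing.Theory Num.Theory numFieldNormedType.Exports.
Local Open Scope classical_set_scope.
Local Open Scope ring_scope.

(** * Flat functions on the real line *)

Section Flat.
Context {R : realType}.
Implicit Types (s : R) (m : nat).

(* The family is closed under differentiation up to linear combinations
   (is_derive_flat), which makes smoothness an induction on the order. *)
Definition flat m s : R := if s <= 0 then 0 else s^-1 ^+ m * expR (- s^-1).

Lemma flat_ge0 m s : 0 <= flat m s.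
Proof.
rewrite /flat; case: (leP s 0) => // s0.
by rewrite mulr_ge0 ?expR_ge0// exprn_ge0// invr_ge0 ltW.
Qed.

Lemma flat_gt0 m s : 0 < s -> 0 < flat m s.
Proof.
move=> s0; rewrite /flat leNgt s0 /=.
by rewrite mulr_gt0 ?expR_gt0// exprn_gt0// invr_gt0.
Qed.

Lemma flat_eq0 m s : s <= 0 -> flat m s = 0.
Proof. by rewrite /flat => ->. Qed.

(** With u = 1/s, the quotient u^(m+2) / (m+2)! is one term of the exponential series of u. The
    factor s^2 makes the difference quotient at 0 tend to 0. *)
Lemma flat_le m s : flat m s <= (m.+2)`!%:R * s ^+ 2.
Proof.
rewrite /flat; case: (leP s 0) => s0; first by rewrite mulr_ge0 ?sqr_ge0 ?ler0n.
have u0 : 0 <= s^-1 by rewrite invr_ge0 ltW.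
rewrite expRN ler_pdivrMr ?expR_gt0//.
have fact0 : 0 < (m.+2)`!%:R :> R by rewrite ltr0n fact_gt0.
have : s^-1 ^+ m.+2 <= (m.+2)`!%:R * expR s^-1.
  rewrite -ler_pdivrMl// mulrC.
  by apply: le_trans (expR_ge1Dxn m.+1 u0); rewrite lerDr.
have -> : s^-1 ^+ m = s ^+ 2 * s^-1 ^+ m.+2.
  rewrite -(addn2 m) exprD mulrCA -exprMn divff ?gt_eqF//.
  by rewrite expr1n mulr1.
by move=> h; rewrite [X in _ <= X * _]mulrC -[leRHS]mulrA ler_wpM2l ?sqr_ge0.
Qed.

Lemma is_derive_flat0 m : is_derive (0 : R) 1 (flat m) 0.
Proof.
have dq0 :
    h^-1 *: ((flat m \o shift 0) (h *: 1) - flat m 0) @[h --> 0^'] --> (0 : R).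
  apply: (@cvg_to_0_linear _ _ (m.+2)`!%:R 1) => // h /andP[h0 _].
  rewrite /= (flat_eq0 _ (lexx 0)) subr0 addr0 [h *: 1]mulr1.
  rewrite normrZ normfV ler_pdivrMl// (ger0_norm (flat_ge0 _ _)).
  rewrite mulrCA -expr2 real_normK ?num_real//; exact: flat_le.
apply: DeriveDef.
  by apply/cvg_ex; exists 0.
by rewrite /derive; apply: cvg_lim.
Qed.

Lemma is_derive_flat m s :
  is_derive s 1 (flat m) (flat m.+2 s - m%:R * flat m.+1 s).
Proof.
have [s0|s0|->] := ltgtP s 0; last first.
- rewrite !flat_eq0// mulr0 subr0; exact: is_derive_flat0.
- pose v := fun y : R => y^-1.
  have sV : is_derive s 1 v (- s ^- 2).
    apply: is_derive_eq; first by apply: is_deriveV; rewrite gt_eqF.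
    by rewrite [LHS]mulr1.
  have eV : is_derive s 1 (expR \o (- v)) (expR (- s^-1) * s ^- 2).
    have := is_derive1_comp (is_derive_expR ((- v) s)) (is_deriveN sV).
    by rewrite opprK.
  have : is_derive s 1 (v ^+ m * (expR \o (- v)))
      (flat m.+2 s - m%:R * flat m.+1 s).
    apply: is_derive_eq.
    rewrite /flat !leNgt s0 /= /v.
    have -> : (GRing.inv ^+ m : R -> R) s = s^-1 ^+ m by rewrite exprfctE.
    have key (u e : R) :
        u ^+ m * (e * u ^+ 2) + e * (m%:R * u ^+ m.-1 * - u ^+ 2) =
        u ^+ m.+2 * e - m%:R * (u ^+ m.+1 * e).
      (* At m = 0 the exponent [m.-1] truncates to 0, but its term carries the factor [m%:R], which
         is 0. *)
      case: m => [|m'] /=.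
        by rewrite !mul0r mulr0 subr0 addr0 mul1r mulrC.
      by rewrite !exprS; move: (m'.+1%:R : R) (u ^+ m') => a b; ring.
    by rewrite -!exprVn; exact: key.
  apply: near_eq_is_derive.
  near=> y; rewrite /flat leNgt ifF; last first.
    by apply/negbTE; rewrite negbK; near: y; exact: lt_nbhsr.
  by rewrite !fctE /v.
- rewrite !flat_eq0 ?ltW// mulr0 subr0.
  apply: near_eq_is_derive (is_derive_cst 0 s 1).
  near=> y; rewrite flat_eq0// ltW//.
  near: y; exact: lt_nbhsl.
Unshelve. all: by end_near. Qed.
End Flat.

(** * Gluing and composition of C^k functions *)

Section CkExtra.
Context {R : realType} {n : nat}.
Implicit Types (U V : set 'rV[R]_n) (f g : 'rV[R]_n -> R).

Lemma Ck_setU k U V f : Ck k U f -> Ck k V f -> Ck k (U `|` V) f.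
Proof.
elim: k f => [|k IH] f /=; first by move=> fU fV x [/fU|/fV].
by move=> [dU DU] [dV DV]; split=> [x [/dU|/dV]|i] //; exact: IH.
Qed.

Lemma derive_comp1 (h : R -> R) f x v (dh : R) : is_derive (f x) 1 h dh ->
  differentiable f x -> 'D_v (h \o f) x = dh * 'D_v f x.
Proof.
move=> hdh df.
have dfh : differentiable h (f x) by apply/derivable1_diffP; exact: ex_derive.
rewrite !deriveE//; last exact: differentiable_comp.
rewrite diff_comp//= -[X in 'd h _ X]mulr1 [X in 'd h _ X]/(_ *: _) linearZ/=.
by have [_ <-] := hdh; rewrite -!deriveE//; exact: mulrC.
Qed.

(** Differentiating brings in the flat functions of indices m+1 and m+2, so the induction on k keeps
    m general. *)
Lemma Ck_flat_comp k U f m : open U -> Ck k U f -> Ck k U (flat m \o f).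
Proof.
move=> oU; elim: k f m => [|k IH] f m.
  move=> fU x Ux; apply: continuous_comp; first exact: fU.
  apply: differentiable_continuous; apply/derivable1_diffP.
  by case: (is_derive_flat m (f x)).
move=> fU; have [df Df] := fU; split=> [x Ux|i].
  apply: differentiable_comp; first exact: df.
  by apply/derivable1_diffP; case: (is_derive_flat m (f x)).
have fk := CkS fU.
have h : Ck k U ((flat m.+2 \o f + cst (- m%:R) * (flat m.+1 \o f)) *
    'D_(delta_mx 0 i) f).
  apply: CkM => //; last exact: Df.
  apply: CkD => //; first exact: IH.
  by apply: CkM => //; [exact: Ck_cst|exact: IH].
apply: Ck_ext h => // x Ux.
by rewrite (derive_comp1 _ (is_derive_flat _ _) (df x Ux)) !fctE mulNr.
Qed.

Lemma Ck_prod (I : Type) (r : seq I) k U (F : I -> 'rV[R]_n -> R) : open U ->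
  (forall i, Ck k U (F i)) -> Ck k U (fun x => \prod_(i <- r) F i x).
Proof.
move=> oU FU.
have -> : (fun x => \prod_(i <- r) F i x) = \prod_(i <- r) F i.
  by apply/funext => x; rewrite fct_prodE.
by apply: big_ind => //; [exact: Ck_cst|move=> ? ?; exact: CkM].
Qed.

End CkExtra.

(** * Bump functions on coordinate space *)

Section Bump.
Context {R : realType} {d : nat}.
Implicit Types (a : 'rV[R]_d) (e : R).

Definition rV_bump a e (x : 'rV[R]_d) : R :=
  \prod_(j < d) flat 0 (e ^+ 2 - (x 0 j - a 0 j) ^+ 2).

Lemma rV_bump_center_gt0 a e : 0 < e -> 0 < rV_bump a e a.
Proof.
move=> e0; apply: prodr_gt0 => j _.
by apply: flat_gt0; rewrite subrr expr0n subr0 exprn_gt0.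
Qed.

(** A nonzero product has no zero factor, so |x_j - a_j| < e for all j; balls of row vectors are
    boxes. *)
Lemma rV_bump_supp a e (x : 'rV[R]_d) :
  0 < e -> rV_bump a e x != 0 -> ball a e x.
Proof.
move=> e0 /prodf_neq0 h; split=> // i j; rewrite ord1.
have {}h := h j isT; rewrite /ball /= distrC ltNge; apply: contra h => h.
apply/eqP; apply: flat_eq0.
by rewrite subr_le0 -[leRHS]real_normK ?num_real// lerXn2r ?nnegrE// ltW.
Qed.

(** The inner map g will be a change of charts. *)
Lemma Ck_rV_bump (n k : nat) (U : set 'rV[R]_n) (g : 'rV[R]_n -> 'rV[R]_d) a e :
  open U -> (forall j, Ck k U (fun x => g x 0 j)) -> Ck k U (rV_bump a e \o g).
Proof.
move=> oU gU; apply: Ck_prod => // j.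
apply: (@Ck_flat_comp _ n _ _ (fun x => e ^+ 2 - (g x 0 j - a 0 j) ^+ 2)) => //.
pose h : 'rV[R]_n -> R := (fun x => g x 0 j) + cst (- a 0 j).
have hU : Ck k U h by apply: CkD => //; exact: Ck_cst.
apply: (@Ck_ext _ _ _ _ (cst (e ^+ 2) + cst (-1) * (h * h))) => //.
  by move=> x _; rewrite /h !fctE mulN1r expr2.
apply: CkD => //; first exact: Ck_cst.
by apply: CkM => //; [exact: Ck_cst|exact: CkM].
Qed.

End Bump.

(** * Bump functions on the manifold *)

Section ManifoldBump.
Context {R : realType} {n : nat} {M : manifold R n}.
Implicit Types (W : set M) (f g : M -> R).

Lemma msmooth_on_ext W f g : open W -> (forall p, W p -> f p = g p) ->
  msmooth_on W f -> msmooth_on W g.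
Proof.
move=> oW fg fW c cM k; apply: Ck_ext (fW c cM k); first exact: coord_open.
by move=> _ [p [Wp dp] <-] /=; rewrite coordK ?inE//; exact: fg.
Qed.

Lemma msmooth_onU W W' f :
  msmooth_on W f -> msmooth_on W' f -> msmooth_on (W `|` W') f.
Proof.
move=> fW fW' c cM k.
by rewrite setIUl image_setU; apply: Ck_setU; [exact: fW|exact: fW'].
Qed.

Lemma msmooth_chart_bump (c : chart R n M) a e : atlas c ->
  msmooth_on (dom c) (rV_bump a e \o coord c).
Proof.
move=> cM d dM k.
apply: (@Ck_rV_bump _ _ _ _ _ (coord c \o par d)).
  by apply: coord_open; exact: dom_open.
by move=> j; rewrite setIC; exact: (atlas_compat dM cM).
Qed.

Lemma exists_bump W p : open W -> W p -> exists2 f : smooth_fun M,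
  f p != 0 & exists2 K, closed K /\ K `<=` W & forall q, ~ K q -> f q = 0.
Proof.
move=> oW Wp; have [c cM dp] := atlas_cover p.
have oU : open (coord c @` (W `&` dom c)) by exact: coord_open.
have Up : (coord c @` (W `&` dom c)) (coord c p) by exists p.
have [e e0 eU] : exists2 e : R, 0 < e &
    closed_ball (coord c p) e `<=` coord c @` (W `&` dom c).
  have /nbhs_ballP[e /= e0 eU] := open_nbhs_nbhs (conj oU Up).
  (* Halving the radius makes room for a closed ball. *)
  exists (e / 2); first by rewrite divr_gt0.
  apply: subset_trans eU; apply: closed_ball_subset; first by rewrite divr_gt0.
  by rewrite ltr_pdivrMr// ltr_pMr// ltr1n.
pose K := par c @` closed_ball (coord c p) e.
have KW : K `<=` W `&` dom c.
  by move=> _ [x /eU[q [Wq dq] <-] <-]; rewrite coordK ?inE.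
have cK : closed K.
  (* K is a continuous image of a compact ball, hence compact, hence closed in the Hausdorff space
     M. *)
  apply: compact_closed; first exact: manifold_hausdorff.
  apply: continuous_compact.
    apply: continuous_subspaceW (@par_continuous _ _ _ c).
    by apply: subset_trans eU _ => _ [q [_ dq] <-]; exists q.
  apply: bounded_closed_compact; last exact: closed_ball_closed.
  exists (`|coord c p| + e); split; first exact: num_real.
  move=> r er x; rewrite closed_ballE// /closed_ball_/= => xe.
  apply: le_trans (ltW er); rewrite -lerBlDl; apply: le_trans xe.
  by rewrite distrC lerB_dist.
pose g q : R := if `[< dom c q >] then rV_bump (coord c p) e (coord c q) else 0.
have gK q : ~ K q -> g q = 0.
  move=> nKq; rewrite /g; case: asboolP => // dq; apply: contrapT => /eqP h.
  apply: nKq; exists (coord c q); last by rewrite coordK ?inE.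
  by apply: subset_closed_ball; exact: rV_bump_supp h.
have gM : g \in @smooth_pred R n M.
  rewrite /smooth_pred inE /=.
  have -> : setT = dom c `|` ~` K.
    apply/esym; rewrite -subTset => q _.
    by have [/KW[]|] := pselect (K q); [left|right].
  apply: msmooth_onU.
    apply: msmooth_on_ext (msmooth_chart_bump _ _ cM); first exact: dom_open.
    by move=> q dq; rewrite /g asboolT.
  have oK : open (~` K) by exact: closed_openC.
  apply: msmooth_on_ext (msmooth_on_cst 0 oK) => // q nKq.
  by rewrite gK.
exists (SmoothFun gM) => /=.
  by rewrite /g asboolT// gt_eqF// rV_bump_center_gt0.
by exists K => //; split=> // q /KW[].
Qed.

End ManifoldBump.

(** * Extension of vectors to global sections *)

Section ExtendVector.
Context {R : realType} {n k : nat} {M : manifold R n} (E : vector_bundle M k).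

Lemma exists_section (p : M) (t : trivialization k E) (w : 'rV[R]_k) :
  bundle_atlas t -> tdom t p -> exists X : Sec E, triv t p (X p) = w.
Proof.
move=> tE tp.
have [f fp [K [cK Kt] fK]] := exists_bump (tdom_open t) tp.
(* A constant vector in the trivialization, cut off by f; dividing by [f p] restores the value w at
   p. *)
pose X0 q : E q :=
  if `[< tdom t q >] then f q *: trivV t q ((f p)^-1 *: w) else 0.
have X0K q : ~ K q -> X0 q = 0.
  by move=> /fK; rewrite /X0; case: asboolP => // tq ->; rewrite scale0r.
have sX : smooth_section X0.
  move=> s sE j.
  (* On the first piece smoothness comes from the transition from t to s; on the second [X0]
     vanishes. *)
  have ss : tdom s = (tdom t `&` tdom s) `|` (tdom s `&` ~` K).
    rewrite [X in X `|` _]setIC -setIUr; apply/esym/setIidl => q _.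
    by have [Kq|] := pselect (K q); [left; exact: Kt|right].
  have ost : open (tdom t `&` tdom s) by apply: openI; exact: tdom_open.
  have osK : open (tdom s `&` ~` K).
    by apply: openI; [exact: tdom_open|exact: closed_openC].
  rewrite ss; apply: msmooth_onU.
    apply: msmooth_on_ext (msmooth_onM ost
      (msmooth_on_sub (@subsetT _ _) (smooth_funP f))
      (bundle_compat tE sE ((f p)^-1 *: w) j)) => //.
    by move=> q [tq _]; rewrite /X0 asboolT// linearZ mxE.
  apply: msmooth_on_ext (msmooth_on_cst 0 osK) => // q [_ nKq].
  by rewrite X0K// linear0 mxE.
exists (MkSec sX); rewrite /= /X0 asboolT// linearZ/= trivVK//.
by rewrite scalerA divff// scale1r.
Qed.

End ExtendVector.

(** * Symbols of quasi-derivations *)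

Section Anchors.
Context {R : realType} {n k : nat} {M : manifold R n} {E : vector_bundle M k}.
Local Notation A := (smooth_fun M).
Local Notation S := (Sec E).
Implicit Types (f g : A) (X Y Z : S) (D : S -> S) (br : S -> S -> S).

Lemma smooth_funext f g : (forall p, f p = g p) -> f = g.
Proof. by move=> fg; apply: val_inj; apply/funext. Qed.

(** A section with a nonzero coordinate at p detects the value at p. This makes symbols unique. *)
Lemma smooth_fun_faithful f g : (0 < k)%N ->
  (forall X, f *: X = g *: X) -> f = g.
Proof.
move=> k0 fg; apply: smooth_funext => p.
have [t tE tp] := bundle_cover E p.
have [X Xp] := exists_section (const_mx 1) tE tp.
have /(congr1 (fun Y : S => triv t p (Y p) 0 (Ordinal k0))) := fg X.
by rewrite /= !linearZ/= Xp !mxE !mulr1.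
Qed.

Lemma collinear_eq0 f X : (1 < k)%N ->
  (forall Y, exists g, f *: Y = g *: X) -> f = 0.
Proof.
move=> k1 fX; apply: smooth_funext => p.
have [t tE tp] := bundle_cover E p.
pose i0 := Ordinal (ltnW k1); pose i1 := Ordinal k1.
pose x := triv t p (X p).
(* Sections through the basis vectors e_j put each f(p) e_j on the line of x. *)
have fE j : exists a : R, forall i, f p * (i == j)%:R = a * x 0 i.
  have [Y Yp] := exists_section (delta_mx 0 j) tE tp.
  have [g /(congr1 (fun Y : S => triv t p (Y p)))] := fX Y.
  rewrite /= !linearZ/= Yp -/x => /rowP gE.
  by exists (g p) => i; have := gE i; rewrite !mxE.
have [a aE] := fE i0; have [b bE] := fE i1.
have := aE i0; have := aE i1; have := bE i1; have := bE i0.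
rewrite !eqxx /= !(mulr0, mulr1) => b0 b1 a1 a0.
apply/eqP; apply: contraT => fp0.
(* f(p)^2 = (a x_0)(b x_1) = (a x_1)(b x_0), and a x_1 = 0. *)
have : f p * f p = 0 
  by rewrite {1}a0 b1 mulrACA [x _ _ * _]mulrC mulrACA -a1 mul0r.
by move/eqP; rewrite mulf_eq0 orbb (negPf fp0).
Qed.

Lemma symbolP D f : quasi_derivation D -> symbol_spec D f (symbol D f).
Proof. by move=> [_ /(_ f)] h; exact: (xgetPex 0 h). Qed.

Lemma symbolE D f df : (0 < k)%N -> symbol_spec D f df -> symbol D f = df.
Proof.
move=> k0 Df; apply: smooth_fun_faithful => // X.
have h : symbol_spec D f (symbol D f).
  by apply: (@xgetPex _ 0 [set df | symbol_spec D f df]); exists df.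
by apply: (addrI (f *: D X)); rewrite -h -Df.
Qed.

Lemma smooth_cst1 X : smooth_cst M 1 *: X = X.
Proof. by apply: SecP => p; exact: scale1r. Qed.

Lemma R_linearD D X Y : R_linear D -> D (X + Y) = D X + D Y.
Proof. by move=> /(_ 1 X Y); rewrite !smooth_cst1. Qed.

Lemma R_linearZ D r X : R_linear D ->
  D (smooth_cst M r *: X) = smooth_cst M r *: D X.
Proof.
move=> DL; have D0 : D 0 = 0.
  by apply: (addrI (D 0)); rewrite addr0 -R_linearD// addr0.
by have := DL r X 0; rewrite !addr0 D0 addr0.
Qed.

(** Expanding D on (r f + g) X and on (f g) X shows that each right-hand side solves the equation
    that determines the symbol. *)
Lemma derivation_symbol D : (0 < k)%N -> quasi_derivation D ->
  derivation (symbol D).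
Proof.
move=> k0 qD; have [DL _] := qD; have Ds f := symbolP f qD.
split=> [r f g|f g]; apply: symbolE => // X.
  rewrite scalerDl R_linearD// -scalerA R_linearZ// !Ds scalerDr !scalerA.
  by rewrite !scalerDl addrACA.
rewrite -scalerA !Ds scalerDr !scalerA scalerDl -addrA.
by congr (_ + _); exact: addrC.
Qed.

(** * Tensoriality of the anchors and their behaviour on brackets *)

Lemma QD_algebroid_flip br :
  QD_algebroid br -> QD_algebroid (fun X Y => br Y X).
Proof. by case=> [[? ?] ? ?]. Qed.

Lemma left_anchor_tensorial br : (1 < k)%N -> QD_algebroid br ->
  tensorial (left_anchor br).
Proof.
move=> k1 [[_ brL] qL qR]; have k0 := ltnW k1; split=> [X|f X Y g].
  exact: derivation_symbol.
have HL X' f' := symbolP f' (qL X').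
have HR X' f' := symbolP f' (qR X').
have lZ : left_anchor br (f *: X) g = f * left_anchor br X g.
  apply/eqP; rewrite -subr_eq0; apply/eqP.
  apply: (@collinear_eq0 _ X) => // Z.
  (* The coefficient of X left after cancelling f g [X, Z] between the two expansions of
     [f X, g Z]. *)
  exists (right_anchor br (g *: Z) f - g * right_anchor br Z f).
  have := HL (f *: X) g Z; rewrite /= (HR (g *: Z) f X) (HR Z f X) (HL X g Z).
  rewrite !scalerDr !scalerA [g * f]mulrC -!addrA => /addrI.
  rewrite !scalerBl -!/(left_anchor _ _ _) -!/(right_anchor _ _ _).
  move: (_ *: Z) (_ *: Z) (_ *: X) (_ *: X) => u v w z h.
  by apply/eqP; rewrite subr_eq addrAC eq_sym subr_eq addrC h addrC.
(* Additivity: the bracket is additive in its first argument, so the symbols add. *)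
rewrite -lZ; apply: symbolE => // Z.
rewrite (R_linearD _ _ (brL _)) HL HL.
by rewrite (R_linearD _ _ (brL _)) scalerDr scalerDl addrACA.
Qed.

Lemma right_anchor_tensorial br : (1 < k)%N -> QD_algebroid br ->
  tensorial (right_anchor br).
Proof.
move=> k1 /QD_algebroid_flip; exact: left_anchor_tensorial.
Qed.

Lemma QD_algebroid_algebroid br : (1 < k)%N -> QD_algebroid br -> algebroid br.
Proof.
move=> k1 qd; split=> //; first exact: left_anchor_tensorial.
exact: right_anchor_tensorial.
Qed.

(** By Jacobi, the operator of [X, Y] is the commutator of those of X and Y. In its value on f Z the
    mixed terms, such as l_X(f) [Y, Z] with l the left anchor, cancel, leaving the commutator of the
    symbols. *)
Lemma left_anchor_bracket br X Y f : (0 < k)%N -> loday_QD_algebroid br ->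
  left_anchor br (br X Y) f =
  left_anchor br X (left_anchor br Y f) - left_anchor br Y (left_anchor br X f).
Proof.
move=> k0 [[[brR _] qL _] jac]; apply: symbolE => // Z.
have HL X' f' := symbolP f' (qL X').
rewrite !jac !HL !(R_linearD _ _ (brR _)) !HL -!/(left_anchor _ _ _).
rewrite scalerBl scalerBr !opprD addrACA.
rewrite [X in X + _ = _]addrACA [X in _ + X = _]addrACA -[LHS]addrA.
by rewrite -[X in _ + (_ + (X + _)) = _]opprB addNKr.
Qed.

End Anchors.

Theorem theorem3 (R : realType) (n k : nat) (M : manifold R n)
    (E : vector_bundle M k) (hk : (1 < k)%N) (br : Sec E -> Sec E -> Sec E) :
  [/\ QD_algebroid br -> algebroid br,
      loday_QD_algebroid br -> loday_algebroid br &
      lie_QD_algebroid br -> lie_algebroid br (left_anchor br)].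
Proof.
split; first exact: QD_algebroid_algebroid.
  by case=> qd jac; split=> //; exact: QD_algebroid_algebroid.
case=> qd lie; have [_ _ jac] := lie; split=> //.
- exact: left_anchor_tensorial.
- by case: qd => _ qL _ X f Y; exact: symbolP.
(* A Lie bracket satisfies Jacobi, so the Loday case applies. *)
- by move=> X Y f; apply: left_anchor_bracket => //; exact: ltnW.
Qed.
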